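(* Let $n\geq 1$ and $k\geq 1$ be integers. There is a bijection between $S(n,k)$ and $I(n,k)$.
   Context: Write $[k]=\{1,\dots,k\}$. $S(n,k)$ is the set of staircase arrays $(C_0,C_1,\dots,C_{n-1})$, where $C_0=\emptyset$ is the empty vector and, for $1\le i\le n-1$, $C_i$ is a vector of length $i$ with each entry in $[k]$; thus $|S(n,k)|=k^{1+2+\cdots+(n-1)}$. A $k$-ary tree is a rooted unlabeled tree in which each vertex has exactly $k$ subtrees in linear order (positions $1,\dots,k$), any of which may be empty; the $r$-th child of a vertex $u$ is the root of its $r$-th subtree (if nonempty). A staircase labeling of a $k$-ary tree $T$ with $n$ vertices is an assignment of labels to the vertices of $T$ such that the labels are vectors $C_0,C_1,\dots,C_{n-1}$, where $C_i$ is a vector of length $i$ with entries in $[k]$ (so each length $0,1,\dots,n-1$ occurs for exactly one vertex), satisfying: for any vertex $u$ with label $C_i$ and any proper descendant $v$ of $u$ with label $C_j$, we have $i<j$, and if the $r$-th child of $u$ lies on the path from $u$ to $v$, then the $(i+1)$-st entry of $C_j$ equals $r$. $I(n,k)$ denotes the set of $k$-ary trees with $n$ vertices together with a staircase labeling. *)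

(* Defs.v *)
From HB Require Import structures.
From mathcomp Require Import all_boot.

Set Implicit Arguments.
Unset Strict Implicit.
Unset Printing Implicit Defensive.

(* Throughout, [k] = {1, ..., k} is represented by 'I_k, i.e. shifted by one. *)

(* The set S(n, k): the component C_i is a vector of length i, 0 <= i < n. *)
Definition staircase_array (n k : nat) : finType :=
  {dffun forall i : 'I_n, i.-tuple 'I_k}.

(* A possibly empty k-ary tree; finite functions make equality extensional. *)
Inductive kary_tree (k : nat) : Type :=
| Empty
| Node of {ffun 'I_k -> kary_tree k}.

Arguments Empty {k}.
Arguments Node {k} _.

(* A vertex is represented by its address: the sequence of child positions    *)
(* followed on the way down from the root, whose own address is [::].         *)
Fixpoint addresses (k : nat) (T : kary_tree k) : seq (seq 'I_k) :=
  match T with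
  | Empty => [::]
  | Node f =>
      [::] :: flatten [seq [seq r :: p | p <- addresses (f r)] | r <- enum 'I_k]
  end.

Definition vertex (k : nat) (T : kary_tree k) : finType :=
  seq_sub (addresses T).

Definition address (k : nat) (T : kary_tree k) (v : vertex T) : seq 'I_k :=
  val v.

Definition proper_descendant (k : nat) (T : kary_tree k) (u v : vertex T) :
  bool := (u != v) && prefix (address u) (address v).

Definition is_child (k : nat) (T : kary_tree k) (u : vertex T) (r : 'I_k)
  (w : vertex T) : bool := address w == rcons (address u) r.

(* w lies on the path from u down to its descendant v *)
Definition on_path (k : nat) (T : kary_tree k) (u v w : vertex T) : bool :=
  prefix (address u) (address w) && prefix (address w) (address v).

(* The first condition says that the labels are C_0, ..., C_(n-1) with C_i of *)
(* length i, each used once.  In the last one, onth is 0-based, so index      *)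
(* i = size (lab u) designates the (i+1)-st entry of the label of v.          *)
Definition is_staircase_labeling (n k : nat) (T : kary_tree k)
  (lab : {ffun vertex T -> seq 'I_k}) : bool :=
  perm_eq [seq size (lab v) | v : vertex T] (iota 0 n) &&
  [forall u : vertex T, forall v : vertex T, proper_descendant u v ==>
     (size (lab u) < size (lab v)) &&
     [forall r : 'I_k, forall w : vertex T,
        is_child u r w && on_path u v w ==>
        (onth (lab v) (size (lab u)) == Some r)]].

(* The set I(n, k).  The conditions are boolean, so that equality of labeled  *)
(* trees does not depend on the proofs. *)
Record labeled_tree (n k : nat) : Type := LabeledTree {
  tree : kary_tree k;
  labeling : {ffun vertex tree -> seq 'I_k};
  tree_card : #|vertex tree| == n;
  labelingP : is_staircase_labeling n labeling
}.

(* Main.v *)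
(** Read a staircase array as an instruction for growing a tree: [C_0] becomes
    the root, and [C_j] is inserted by walking down from the root, leaving a
    vertex labeled [C_i] through its child number [C_j(i+1)], until an unoccupied
    position is reached.  Conversely a labeled tree yields the array of its
    labels.  This second map is injective because the labeling conditions force
    every label to sit where the insertion procedure puts it, and insertion is
    a right inverse of it. *)

Require Import Defs.
From mathcomp Require Import all_boot.

Set Implicit Arguments.
Unset Strict Implicit.
Unset Printing Implicit Defensive.

(** * Trees and their sets of addresses *)

Lemma mem_addresses_cons k (f : {ffun 'I_k -> kary_tree k}) r p :
  (r :: p \in addresses (Node f)) = (p \in addresses (f r)).
Proof.
rewrite /= in_cons /=; apply/flatten_mapP/idP => [[r' _ /mapP[q fq [-> ->]]]//|].
by move=> fp; exists r; rewrite ?mem_enum //; apply/mapP; exists p.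
Qed.

Lemma addresses_prefix k (T : kary_tree k) p q :
  prefix p q -> q \in addresses T -> p \in addresses T.
Proof.
move=> /prefixP[s ->]; elim: p T => [|r p IHp] [|f] //.
by rewrite cat_cons !mem_addresses_cons; apply: IHp.
Qed.

Lemma addresses_inj k (T U : kary_tree k) : addresses T =i addresses U -> T = U.
Proof.
(* A direct [fix], because the subtrees are nested inside a finite function. *)
move: T U; fix IH 1 => -[|f] [|g] eqTU //.
- by have := eqTU [::]; rewrite !inE.
- by have := eqTU [::]; rewrite !inE.
congr Node; apply/ffunP => r; apply: IH => p.
by rewrite -!mem_addresses_cons eqTU.
Qed.

(** The fuel [d] makes the recursion structural; it truncates the tree at depth [d], harmlessly once
    [d] exceeds the length of every address in [P]. *)
Fixpoint tree_of k (d : nat) (P : pred (seq 'I_k)) : kary_tree k :=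
  if d is d'.+1 then
    if P [::] then Node [ffun r => tree_of d' (fun p => P (r :: p))] else Empty
  else Empty.

Lemma mem_tree_of k d (P : pred (seq 'I_k)) :
  (forall p q, prefix p q -> P q -> P p) ->
  forall p, (p \in addresses (tree_of d P)) = (size p < d) && P p.
Proof.
elim: d P => [//|d IHd] P clP p /=.
have [P0|nP0] := boolP (P [::]); last first.
  by rewrite in_nil (contraNF (clP _ _ (prefix0s p)) nP0) andbF.
case: p => [|r p]; first by rewrite P0 inE.
rewrite mem_addresses_cons ffunE IHd //= => q q' qq'.
by apply: clP; rewrite /= eqxx.
Qed.

(** * The insertion procedure *)

(* [ps] lists the addresses occupied so far: [nth [::] ps i] is that of [C_i]. *)
Definition walk k (r0 : 'I_k) (ps : seq (seq 'I_k)) (c : seq 'I_k) t :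
  seq 'I_k := iter t (fun q => rcons q (nth r0 c (index q ps))) [::].

(** The walk does not stop by itself: past a free address [index] returns [size ps] and the steps
    lose their meaning, so only the first free stop is kept. *)
Definition free_address k (r0 : 'I_k) ps c : seq 'I_k :=
  walk r0 ps c (find (fun t => walk r0 ps c t \notin ps) (iota 0 (size ps).+1)).

Fixpoint insertion k (r0 : 'I_k) (C : nat -> seq 'I_k) (n : nat) :=
  if n is m.+1 then
    let ps := insertion r0 C m in rcons ps (free_address r0 ps (C m))
  else [::].

Lemma size_walk k (r0 : 'I_k) ps c t : size (walk r0 ps c t) = t.
Proof. by elim: t => //= t IHt; rewrite size_rcons IHt. Qed.

Lemma take_walk k (r0 : 'I_k) ps c s t :
  s <= t -> take s (walk r0 ps c t) = walk r0 ps c s.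
Proof.
elim: t => [|t IHt] /=; first by rewrite leqn0 => /eqP->.
rewrite leq_eqVlt ltnS => /predU1P[->|le_st].
  by rewrite take_oversize // size_rcons size_walk.
by rewrite -cats1 takel_cat ?size_walk ?IHt.
Qed.

Lemma nth_walk k (r0 : 'I_k) ps c s t :
  s < t -> nth r0 (walk r0 ps c t) s = nth r0 c (index (walk r0 ps c s) ps).
Proof.
move=> lt_st; rewrite -(nth_take _ (ltnSn s)) take_walk //= nth_rcons.
by rewrite size_walk ltnn eqxx.
Qed.

(** Pigeonhole: the stops have pairwise distinct lengths, so [(size ps).+1] of them cannot all be
    occupied. *)
Lemma free_addressP k (r0 : 'I_k) ps c :
  exists2 t, free_address r0 ps c = walk r0 ps c t &
    walk r0 ps c t \notin ps /\ (forall s, s < t -> walk r0 ps c s \in ps).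
Proof.
rewrite /free_address; set t := find _ _.
pose a t' := walk r0 ps c t' \notin ps.
have has_a : has a (iota 0 (size ps).+1).
  apply/negPn/negP => /hasPn in_ps.
  suff: size (map (walk r0 ps c) (iota 0 (size ps).+1)) <= size ps.
    by rewrite size_map size_iota ltnn.
  apply: uniq_leq_size.
    rewrite map_inj_uniq ?iota_uniq // => s s' /(congr1 size).
    by rewrite !size_walk.
  by move=> _ /mapP[s /in_ps /negPn s_ps ->].
have lt_t : t < (size ps).+1 by rewrite -(size_iota 0 (size ps).+1) -has_find.
exists t => //; split; first by have := nth_find 0 has_a; rewrite nth_iota.
move=> s lt_st; have /negbFE := before_find 0 lt_st.
by rewrite nth_iota // (ltn_trans lt_st).
Qed.

Lemma size_insertion k (r0 : 'I_k) C n : size (insertion r0 C n) = n.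
Proof. by elim: n => //= n IHn; rewrite size_rcons IHn. Qed.

Lemma insertion_uniq k (r0 : 'I_k) C n : uniq (insertion r0 C n).
Proof.
elim: n => //= n IHn; rewrite rcons_uniq IHn andbT.
by have [t -> []] := free_addressP r0 (insertion r0 C n) (C n).
Qed.

(** The staircase condition in terms of addresses. The proper prefixes of a new address are the
    earlier stops of its walk, all occupied; later insertions append to the list and so preserve
    every index. *)
Lemma insertion_take k (r0 : 'I_k) C n j s (ps := insertion r0 C n)
    (p := nth [::] ps j) :
  j < n -> s < size p ->
  index (take s p) ps < j /\ nth r0 p s = nth r0 (C j) (index (take s p) ps).
Proof.
rewrite {}/p {}/ps; elim: n => // n IHn; rewrite ltnS /= => le_jn.
set ps := insertion r0 C n in IHn *.
have sz_ps : size ps = n by apply: size_insertion.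
have indexE q x : index q ps < n -> index q (rcons ps x) = index q ps.
  by rewrite -sz_ps index_mem -cats1 index_cat => ->.
rewrite nth_rcons sz_ps; have [lt_jn|_] := ltnP j n.
  move=> /(IHn lt_jn)[lt_ij eq_p].
  by rewrite (indexE _ _ (ltn_trans lt_ij lt_jn)).
case: eqP => [->|//] {j IHn le_jn}.
have [t -> [_ in_ps]] := free_addressP r0 ps (C n).
rewrite size_walk => lt_st; rewrite take_walk ?(ltnW lt_st) //.
have lt_in : index (walk r0 ps (C n) s) ps < n.
  by have := in_ps s lt_st; rewrite -index_mem sz_ps.
by rewrite indexE // nth_walk.
Qed.

Lemma insertion_prefix k (r0 : 'I_k) C n p q :
  prefix p q -> q \in insertion r0 C n -> p \in insertion r0 C n.
Proof.
rewrite prefixE => /eqP <-; set s := size p; set ps := insertion r0 C n => q_ps.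
have [le_qs|lt_sq] := leqP (size q) s; first by rewrite take_oversize.
have lt_jn : index q ps < n by rewrite -(size_insertion r0 C n) index_mem.
have := @insertion_take _ r0 C n (index q ps) s lt_jn.
rewrite nth_index // => /(_ lt_sq)[lt_ij _].
by rewrite -index_mem size_insertion (ltn_trans lt_ij).
Qed.

(** * The labeled tree grown by insertion *)

Definition insertion_tree k (r0 : 'I_k) C n : kary_tree k :=
  let ps := insertion r0 C n in
  tree_of (\max_(p <- ps) size p).+1 [in ps].

Lemma mem_insertion_tree k (r0 : 'I_k) C n :
  addresses (insertion_tree r0 C n) =i insertion r0 C n.
Proof.
move=> p; rewrite mem_tree_of; last exact: insertion_prefix.
apply/andb_idl => /= p_ps; rewrite ltnS.
exact: (leq_bigmax_seq (F := size) p p_ps).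
Qed.

Definition insertion_labeling k (r0 : 'I_k) C n :
    {ffun vertex (insertion_tree r0 C n) -> seq 'I_k} :=
  [ffun v => C (index (address v) (insertion r0 C n))].

(** Label lengths are insertion ranks, so the first condition reflects that the inserted addresses
    are distinct, and the second is [insertion_take] at [s = size (address u)]. *)
Lemma insertion_labelingP k (r0 : 'I_k) C n :
  (forall i, i < n -> size (C i) = i) ->
  is_staircase_labeling n (insertion_labeling r0 C n).
Proof.
move=> szC; set ps := insertion r0 C n.
have v_ps (v : vertex (insertion_tree r0 C n)) : address v \in ps.
  by rewrite -mem_insertion_tree; apply: valP.
have lt_v (v : vertex (insertion_tree r0 C n)) : index (address v) ps < n.
  by rewrite -[X in _ < X](size_insertion r0 C n) index_mem.
have sz_lab v : size (insertion_labeling r0 C n v) = index (address v) ps.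
  by rewrite ffunE szC.
apply/andP; split.
  apply: uniq_perm; rewrite ?iota_uniq //.
    rewrite map_inj_uniq ?enum_uniq // => u v; rewrite !sz_lab => eq_uv.
    exact: val_inj (index_inj [::] (v_ps u) (v_ps v) eq_uv).
  move=> i; rewrite mem_iota add0n /=; apply/mapP/idP => [[v _ ->]|lt_in].
    by rewrite sz_lab.
  have lt_i_ps : i < size ps by rewrite size_insertion.
  have p_T : nth [::] ps i \in addresses (insertion_tree r0 C n).
    by rewrite mem_insertion_tree mem_nth.
  exists (SeqSub p_T); rewrite ?mem_enum // sz_lab.
  by rewrite index_uniq ?insertion_uniq.
apply/forallP => u; apply/forallP => v; apply/implyP => /andP[neq_uv pre_uv].
have lt_s : size (address u) < size (address v).
  rewrite ltnNge; apply: contra neq_uv => le_vu.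
  by rewrite -val_eqE /=; move: pre_uv; rewrite prefixE take_oversize // eq_sym.
have := @insertion_take _ r0 C n _ (size (address u)) (lt_v v).
rewrite nth_index // => /(_ lt_s).
move: pre_uv; rewrite prefixE => /eqP-> [lt_uv nth_v].
rewrite !sz_lab lt_uv /=; apply/forallP => r; apply/forallP => w.
apply/implyP => /andP[/eqP w_ur /andP[_ /prefixP[q v_wq]]].
have: nth r0 (address v) (size (address u)) = r.
  by rewrite v_wq w_ur cat_rcons nth_cat ltnn subnn.
(* [nth] could return [r0] by default; this is ruled out since the rank of [u] is below the length
   of the label of [v]. *)
rewrite nth_v -odflt_onth ffunE -/ps; case E: (onth _ _) => [x|] /= => [->//|_].
have := onthTE (C (index (address v) ps)) (index (address u) ps).
by rewrite E szC // lt_uv.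
Qed.

(** * The array of labels of a labeled tree *)

Lemma size_label_inj n k (t : labeled_tree n k) :
  injective (fun v => size (labeling t v)).
Proof.
apply/injectiveP; rewrite /injectiveb /dinjectiveb.
by have /andP[/perm_uniq-> _] := labelingP t; rewrite iota_uniq.
Qed.

Lemma size_label_lt n k (t : labeled_tree n k) v : size (labeling t v) < n.
Proof.
have /andP[/perm_mem mem_sz _] := labelingP t.
have: size (labeling t v) \in iota 0 n.
  by rewrite -mem_sz; apply/mapP; exists v; rewrite ?mem_enum.
by rewrite mem_iota.
Qed.

Lemma size_label_surj n k (t : labeled_tree n k) i :
  i < n -> exists v, size (labeling t v) == i.
Proof.
move=> lt_in; have /andP[/perm_mem mem_sz _] := labelingP t.
have: i \in iota 0 n by rewrite mem_iota.
by rewrite -mem_sz => /mapP[v _ ->]; exists v.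
Qed.

(** The sequence is inferred from the type of [xchooseP]: it is the label of the chosen vertex,
    unique by [size_label_inj]. *)
Definition label_array n k (t : labeled_tree n k) : staircase_array n k :=
  [ffun i : 'I_n =>
     Tuple (xchooseP (size_label_surj t (ltn_ord i))) : i.-tuple 'I_k].

Lemma label_arrayE n k (t : labeled_tree n k) (i : 'I_n) v :
  size (labeling t v) = i -> label_array t i = labeling t v :> seq _.
Proof.
move=> sz_v; rewrite ffunE /=; congr (labeling t _); apply: (@size_label_inj _ _ t).
by rewrite sz_v; apply/eqP/(xchooseP (size_label_surj t (ltn_ord i))).
Qed.

(** Counterpart of [insertion_take] for an arbitrary labeled tree: the labeling condition is applied
    to the ancestor of [v] at depth [s] and to the next vertex [w] on the path. *)
Lemma label_take n k (t : labeled_tree n k) (v : vertex (tree t)) s :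
  s < size (address v) ->
  exists u : vertex (tree t), [/\ address u = take s (address v),
    size (labeling t u) < size (labeling t v) &
    onth (labeling t v) (size (labeling t u)) = onth (address v) s].
Proof.
move=> lt_sv; have /andP[_ /forallP lab_t] := labelingP t.
have mem_take i : take i (address v) \in addresses (tree t).
  by apply: addresses_prefix (prefix_take _ _) _; apply: valP.
pose u : vertex (tree t) := SeqSub (mem_take s).
pose w : vertex (tree t) := SeqSub (mem_take s.+1).
have sz_u : size (address u) = s by rewrite size_take lt_sv.
have desc_uv : proper_descendant u v.
  rewrite /proper_descendant prefix_take andbT; apply: contraTneq lt_sv => eq_uv.
  by rewrite -{1}eq_uv sz_u ltnn.
have /implyP/(_ desc_uv)/andP[lt_uv /forallP lab_uv] := forallP (lab_t u) v.
exists u; split=> //; case def_r: (onth (address v) s) => [r|]; last first.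
  by have := onthTE (address v) s; rewrite def_r lt_sv.
have w_def : address w = rcons (address u) r.
  by rewrite -[LHS]/(take _ _) (take_nth r) // (onth_nth r _ _ _ def_r).
have := forallP (lab_uv r) w; rewrite /is_child /on_path w_def eqxx /=.
by rewrite prefix_rcons -w_def prefix_take => /eqP.
Qed.

Lemma eq_label_array n k (t u : labeled_tree n k) v w :
  label_array t = label_array u -> size (labeling t v) = size (labeling u w) ->
  labeling t v = labeling u w.
Proof.
move=> eq_tu eq_vw; have lt_v := size_label_lt v.
rewrite -(label_arrayE (i := Ordinal lt_v) erefl) eq_tu.
by apply: label_arrayE; rewrite -eq_vw.
Qed.

(** Strong induction on the label length. Ancestors carry shorter labels, so they sit at the same
    address in both trees, and the common label dictates which child comes next; hence the addresses
    agree as far as both go. *)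
Lemma eq_label_address n k (t u : labeled_tree n k) v w :
  label_array t = label_array u -> size (labeling t v) = size (labeling u w) ->
  address v = address w.
Proof.
move: {2}(size _).+1 (ltnSn (size (labeling t v))) => m.
elim: m => // m IHm in t u v w *; rewrite ltnS => le_vm eq_tu eq_vw.
wlog le_vw: t u v w le_vm eq_tu eq_vw / size (address v) <= size (address w).
  move=> H; case/orP: (leq_total (size (address v)) (size (address w))) => le_a.
    exact: H.
  by apply/esym/H; rewrite -?eq_vw.
have take_vw s : s <= size (address v) -> take s (address v) = take s (address w).
  elim: s => [|s IHs] lt_sv; first by rewrite !take0.
  have lt_sw := leq_trans lt_sv le_vw.
  have [x [x_v lt_xv next_v]] := label_take lt_sv.
  have [y [y_w _ next_w]] := label_take lt_sw.
  have [y' /eqP sz_y'] := size_label_surj u (size_label_lt x).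
  (* By induction [y'] has the address of [x], which is that of [y] by the inner hypothesis. *)
  have eq_y : y' = y.
    apply: val_inj; rewrite -[LHS](IHm t u x y') // ?(leq_trans lt_xv) //.
    by rewrite -[RHS]/(address y) y_w x_v IHs // ltnW.
  have eq_s : onth (address v) s = onth (address w) s.
    by rewrite -next_v -next_w -eq_y sz_y' (eq_label_array eq_tu eq_vw).
  (* The first entry of the nonempty [address v] serves as default for [nth]. *)
  case: (address v) lt_sv lt_sw eq_s (IHs (ltnW lt_sv)) => // r0 p lt_sv lt_sw.
  by move=> eq_s eq_take; rewrite !(take_nth r0) // -!odflt_onth eq_s eq_take.
have v_def : address v = take (size (address v)) (address w).
  by rewrite -take_vw // take_size.
have [le_wv|lt_vw] := leqP (size (address w)) (size (address v)).
  by rewrite v_def take_oversize.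
(* If [address v] were a proper prefix of [address w], the vertex [y] there would have a shorter
   label than [w]; its counterpart [x] in [t] would be [v] by induction, whose label is as long as
   that of [w]. *)
have [y [y_w lt_yw _]] := label_take lt_vw.
have [x /eqP sz_x] := size_label_surj t (size_label_lt y).
have eq_x : x = v.
  apply: val_inj; rewrite -[LHS]/(address x) (IHm t u x y) //.
    by rewrite y_w -v_def.
  by rewrite sz_x (leq_trans lt_yw) // -eq_vw.
by rewrite -sz_x eq_x eq_vw ltnn in lt_yw.
Qed.

Lemma label_array_inj n k : injective (@label_array n k).
Proof.
move=> t u eq_tu.
have sub_addr t1 t2 : label_array t1 = label_array t2 ->
    {subset addresses (tree t1) <= addresses (tree t2)} => [eq_t p p_T|].
  have [w /eqP sz_w] := size_label_surj t2 (size_label_lt (SeqSub p_T : vertex _)).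
  rewrite -[p]/(address (SeqSub p_T : vertex _)).
  by rewrite (eq_label_address eq_t (esym sz_w)); apply: valP.
have eqT : tree t = tree u.
  by apply: addresses_inj => p; apply/idP/idP; apply: sub_addr.
have eqL v w : address v = address w -> labeling t v = labeling u w.
  move=> eq_vw; have [w' /eqP sz_w'] := size_label_surj u (size_label_lt v).
  rewrite (eq_label_array eq_tu (esym sz_w')); congr (labeling u _).
  apply: val_inj; rewrite -[val w]eq_vw.
  by rewrite (eq_label_address eq_tu (esym sz_w')).
(* The type of a labeling depends on the tree, so [eqT] is eliminated before the labelings are
   identified. *)
case: t u eqT eqL {eq_tu sub_addr} => T l c P [U m c' P'] /= eqT.
case: U / eqT in m c' P' * => eqL.
have eq_lm : l = m by apply/ffunP => v; apply: eqL.
by case: m / eq_lm in P' {eqL} *; congr LabeledTree; apply: bool_irrelevance.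
Qed.

(** Makes the dependent family a total function for [insertion], which reads only indices below
    [n]. *)
Definition array_label n k (A : staircase_array n k) (i : nat) : seq 'I_k :=
  if insub i is Some j then A j else [::].

Lemma array_labelE n k (A : staircase_array n k) (i : 'I_n) :
  array_label A i = A i.
Proof. by rewrite /array_label valK. Qed.

Lemma size_array_label n k (A : staircase_array n k) i :
  i < n -> size (array_label A i) = i.
Proof. by move=> lt_in; rewrite (array_labelE A (Ordinal lt_in)) size_tuple. Qed.

Lemma staircase_card n k (T : kary_tree k) (lab : {ffun vertex T -> seq 'I_k}) :
  is_staircase_labeling n lab -> #|vertex T| == n.
Proof.
by case/andP=> /perm_size + _; rewrite size_map -cardE size_iota => ->.
Qed.

Definition insertion_labeled_tree n k (r0 : 'I_k) (A : staircase_array n k) :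
    labeled_tree n k :=
  let P := insertion_labelingP r0 (@size_array_label n k A) in
  LabeledTree (staircase_card P) P.

Lemma insertion_labeled_treeK n k (r0 : 'I_k) :
  cancel (@insertion_labeled_tree n k r0) (@label_array n k).
Proof.
move=> A; apply/ffunP => i; apply: val_inj => /=.
have [v /eqP sz_v] := size_label_surj (insertion_labeled_tree r0 A) (ltn_ord i).
rewrite (label_arrayE sz_v) -array_labelE -{}sz_v /= ffunE size_array_label //.
rewrite -[X in _ < X](size_insertion r0 (array_label A)) index_mem.
by rewrite -mem_insertion_tree; apply: valP.
Qed.

Theorem theorem2p2 (n k : nat) (hn : 1 <= n) (hk : 1 <= k) :
  exists f : staircase_array n k -> labeled_tree n k, bijective f.
Proof.
(* Positivity of [k] supplies the default entry of the walks. *)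
pose r0 := Ordinal hk; exists (insertion_labeled_tree r0).
exists (@label_array n k); first exact: insertion_labeled_treeK.
(* A right inverse of an injective map is also a left inverse. *)
by move=> t; apply: label_array_inj; rewrite insertion_labeled_treeK.
Qed.
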